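(* Let $\kappa\in\{1,2,\dots\}$, let $D\subseteq\mathbb{C}$ be an open or closed disc or an open or closed half-plane, and let $P(\lambda)\in\mathbb{C}^{n,n}[\lambda]$ be a matrix polynomial of degree at most $\kappa$. Then $P(\lambda)$ is hyperstable with respect to $D$ if and only if the $\kappa$-variable matrix polynomial $(T_\kappa P)(z_1,\dots,z_\kappa)$ is hyperstable with respect to $D^\kappa$.
   Context: For $P(\lambda)=\lambda^dA_d+\dots+\lambda A_1+A_0\in\mathbb{C}^{n,n}[\lambda]$ of degree $d\leq\kappa$, put $A_{d+1}=\dots=A_\kappa=0$. The polarisation operator $T_\kappa$ is defined by $$(T_\kappa P)(z_1,\dots,z_\kappa):=\sum_{j=0}^\kappa\binom{\kappa}{j}^{-1}s_j(z_1,\dots,z_\kappa)A_j,$$ where $s_0:=1$ and $s_j(z_1,\dots,z_\kappa):=\sum_{1\leq i_1<\dots<i_j\leq\kappa}z_{i_1}\cdots z_{i_j}$ is the $j$-th elementary symmetric polynomial. Discs have positive radius. A matrix polynomial $Q(z_1,\dots,z_m)\in\mathbb{C}^{n,n}[z_1,\dots,z_m]$ ($m\geq1$) is hyperstable with respect to a nonempty open or closed set $\Omega\subseteq\mathbb{C}^m$ if for every $x\in\mathbb{C}^n\setminus\{0\}$ there exists $y\in\mathbb{C}^n\setminus\{0\}$ such that $y^*Q(w_1,\dots,w_m)x\neq0$ for all $(w_1,\dots,w_m)\in\Omega$. (For $m=1$ the definition is made for regular polynomials, i.e. those with $\det Q\not\equiv0$, but the condition forces regularity.) *)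

(* Defs.v *)
From mathcomp Require Import all_boot all_order all_algebra.
From mathcomp Require Import classical_sets reals.
From mathcomp Require Import complex mpoly.

Set Implicit Arguments.
Unset Strict Implicit.
Unset Printing Implicit Defensive.

Import Order.TTheory GRing.Theory Num.Theory.
Local Open Scope classical_set_scope.
Local Open Scope ring_scope.
Local Open Scope complex_scope.
Local Open Scope sesquilinear_scope.

(* The complex numbers are [R[i]] with [R : realType].  Matrix polynomials are
   matrices with polynomial entries: ['M[{poly R[i]}]_n] in one variable,
   ['M[{mpoly R[i][m]}]_n] in [m] variables. *)

Section Regions.
Variable R : realType.
Implicit Types (a c z : R[i]) (b r : R).

Definition open_disc c r : set R[i] := [set z | `|z - c| < r%:C].
Definition closed_disc c r : set R[i] := [set z | `|z - c| <= r%:C].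

(* These are half-planes only for [a != 0]. *)
Definition open_half_plane a b : set R[i] := [set z | b < complex.Re (a * z)].
Definition closed_half_plane a b : set R[i] := [set z | b <= complex.Re (a * z)].

Definition disc_or_half_plane (D : set R[i]) : Prop :=
  (exists c r, 0 < r /\ (D = open_disc c r \/ D = closed_disc c r)) \/
  (exists a b, a != 0 /\ (D = open_half_plane a b \/ D = closed_half_plane a b)).

Definition set_power (D : set R[i]) (m : nat) : set ('I_m -> R[i]) :=
  [set w | forall i, D (w i)].

End Regions.

Arguments set_power {R} D m _ : rename.

Section MatrixPolynomials.
Variables (R : realType) (n : nat).

Definition mxpoly_eval (P : 'M[{poly R[i]}]_n) (z : R[i]) : 'M[R[i]]_n :=
  map_mx (fun p : {poly R[i]} => p.[z]) P.

Definition mxpoly_coef (P : 'M[{poly R[i]}]_n) (j : nat) : 'M[R[i]]_n :=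
  map_mx (fun p : {poly R[i]} => p`_j) P.

Definition mxmpoly_eval (m : nat) (Q : 'M[{mpoly R[i][m]}]_n)
    (w : 'I_m -> R[i]) : 'M[R[i]]_n :=
  map_mx (fun p : {mpoly R[i][m]} => p.@[w]) Q.

(* [d] bounds the degree; the zero polynomial has every degree bound. *)
Definition mxpoly_deg_le (d : nat) (P : 'M[{poly R[i]}]_n) : Prop :=
  forall i j, (size (P i j) <= d.+1)%N.

(* Regularity ([\det P != 0]) is not required separately: it follows, see
   [hyperstable1_regular]. *)
Definition hyperstable1 (Omega : set R[i]) (P : 'M[{poly R[i]}]_n) : Prop :=
  forall x : 'cV[R[i]]_n, x != 0 ->
  exists2 y : 'cV[R[i]]_n, y != 0 &
    forall w, Omega w -> (y^t* *m mxpoly_eval P w *m x) 0 0 != 0.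

Definition hyperstable (m : nat) (Omega : set ('I_m -> R[i]))
    (Q : 'M[{mpoly R[i][m]}]_n) : Prop :=
  forall x : 'cV[R[i]]_n, x != 0 ->
  exists2 y : 'cV[R[i]]_n, y != 0 &
    forall w, Omega w -> (y^t* *m mxmpoly_eval Q w *m x) 0 0 != 0.

(* [mesym k R[i] j] is the [j]-th elementary symmetric polynomial in [k]
   variables. *)
Definition polarisation (k : nat) (P : 'M[{poly R[i]}]_n) :
    'M[{mpoly R[i][k]}]_n :=
  \sum_(j < k.+1)
    (('C(k, j)%:R : R[i])^-1 *: mesym k R[i] j)
      *: map_mx (@mpolyC k R[i]) (mxpoly_coef P j).

Lemma hyperstable1_regular (Omega : set R[i]) (P : 'M[{poly R[i]}]_n) :
  Omega !=set0 -> hyperstable1 Omega P -> \det P != 0.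
Proof.
move=> [w Ow] hP; apply/eqP => detP0.
have : \det (mxpoly_eval P w)^T = 0.
  rewrite det_tr -[mxpoly_eval P w]/(map_mx (horner_eval w) P).
  by rewrite det_map_mx detP0 rmorph0.
move/eqP/det0P => [v v0 vP].
have [|y _ /(_ w Ow)] := hP v^T; first by rewrite trmx_eq0.
by rewrite -mulmxA -[mxpoly_eval P w]trmxK -trmx_mul vP trmx0 mulmx0 mxE eqxx.
Qed.

End MatrixPolynomials.

(* Main.v *)
(* For fixed x and y, the scalar polynomial p = y^* P x polarises to
   y^* (T_k P) x, and restricting T_k P to the diagonal gives back P.  So the
   theorem follows, with the same y on both sides, from the Grace-Walsh-Szego
   theorem: if deg p <= k and p has no zero in D, then its polar form has no
   zero in D^k.

   Fixing one variable w of the polar form of p gives, up to the factor 1/k,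
   the polar form in k - 1 variables of k p + (w - X) p'.  By induction it is
   enough that this polar derivative has no zero in D (Laguerre).  At z in D it
   equals k p(z) (1 + (w - z) m), where m is the mean of the numbers
   1 / (z - a), a ranging over the roots of p, padded with zeros to length k.
   These numbers lie in {c | c = 0 or z - 1/c notin D}, which is convex because
   D is a disc or a half-plane; hence so does m.  But 1 + (w - z) m = 0 would
   give z - 1/m = w in D. *)
Require Import Defs.
From mathcomp Require Import all_boot all_order all_algebra.
From mathcomp Require Import classical_sets reals.
From mathcomp Require Import complex mpoly.
From mathcomp Require Import ring lra.

Set Implicit Arguments.
Unset Strict Implicit.
Unset Printing Implicit Defensive.

Import Order.TTheory GRing.Theory Num.Theory.
Local Open Scope ring_scope.
Local Open Scope complex_scope.
Local Open Scope sesquilinear_scope.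

(** * Elementary symmetric polynomials and scalar polar forms *)

Section ElementarySymmetric.
Variable F : fieldType.
Implicit Types (s : seq F) (p : {poly F}).

(** Encoded through the generating product, so that adding a variable multiplies by one linear
    factor. *)
Definition esym s j : F := (\prod_(c <- s) (1 + c *: 'X))`_j.

Lemma esym_nil j : esym [::] j = (j == 0)%:R.
Proof. by rewrite /esym big_nil coef1. Qed.

Lemma esym_cons0 c s : esym (c :: s) 0 = esym s 0.
Proof.
rewrite /esym big_cons mulrDl mul1r -scalerAl coefD coefZ coefXM.
by rewrite mulr0 addr0.
Qed.

Lemma esym_consS c s j : esym (c :: s) j.+1 = esym s j.+1 + c * esym s j.
Proof. by rewrite /esym big_cons mulrDl mul1r -scalerAl coefD coefZ coefXM. Qed.

Lemma esym_oversize s j : (size s < j)%N -> esym s j = 0.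
Proof.
elim: s j => [|c s IHs] [|j] //= ltsj; first by rewrite esym_nil.
by rewrite esym_consS !IHs ?mulr0 ?addr0 // ltnW.
Qed.

Lemma esym_nseq k c j : esym (nseq k c) j = 'C(k, j)%:R * c ^+ j.
Proof.
elim: k j => [|k IHk] [|j]; rewrite ?esym_nil ?bin0n ?mul0r ?mulr1 //.
  by rewrite esym_cons0 IHk !bin0 mulr1.
by rewrite esym_consS !IHk binS natrD exprS; ring.
Qed.

Lemma meval_mesym k (w : 'I_k -> F) j :
  (mesym k F j).@[w] = esym (codom w) j.
Proof.
rewrite /esym big_map big_enum /= (eq_bigr (fun i => w i *: 'X + 1)); last first.
  by move=> i _; rewrite addrC.
rewrite bigA_distr coef_sum /mesym raddf_sum [LHS]big_mkcond /=.
apply: eq_bigr => h _; rewrite -big_mkcond /= scaler_prod prodr_const.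
rewrite coefZ coefXn eq_sym rmorph_prod /=.
case: ifP => _; rewrite ?mulr1 ?mulr0 //.
by apply: eq_bigr => i _; rewrite mevalXU.
Qed.

(** The scalar polarisation at the point [s], whose length is the number of variables. *)
Definition polar_form p s : F :=
  \sum_(j < (size s).+1) ('C(size s, j)%:R)^-1 * esym s j * p`_j.

(** Laguerre's polar derivative with pole [w], for [p] regarded as having degree [m]. *)
Definition polar_deriv m (w : F) p : {poly F} := p *+ m + (w%:P - 'X) * p^`().

Lemma coef_polar_deriv m w p j :
  (polar_deriv m w p)`_j = (m%:R - j%:R) * p`_j + j.+1%:R * (w * p`_j.+1).
Proof.
rewrite /polar_deriv coefD coefMn mulrBl coefB coefCM coefXM !coef_deriv.
have -> : (if j == 0 then 0 else p`_j.-1.+1 *+ j.-1.+1) = j%:R * p`_j.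
  by case: j => [|j] /=; rewrite ?mul0r // mulr_natl.
by rewrite mulr_natl mulrBl !mulr_natl mulrnAr addrCA addrC -addrA addrC -!addrA.
Qed.

Lemma size_polar_deriv k w p :
  (size p <= k.+2)%N -> (size (polar_deriv k.+1 w p) <= k.+1)%N.
Proof.
move=> sp; apply/leq_sizeP => j; rewrite coef_polar_deriv leq_eqVlt.
(* At the top index the factor [m - j] of the coefficient vanishes, so the degree drops. *)
case/predU1P => [<-|ltkj].
  by rewrite (nth_default 0 sp) subrr !(mulr0, mul0r, addr0).
by rewrite !nth_default ?mulr0 ?addr0 // (leq_trans sp) // ltnW.
Qed.
End ElementarySymmetric.

Lemma polar_form_cons (F : numFieldType) (p : {poly F}) w s :
  polar_form p (w :: s) =
    (size s).+1%:R^-1 * polar_form (polar_deriv (size s).+1 w p) s.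
Proof.
rewrite /polar_form /=; set m := size s.
have bn0 a b : (b <= a)%N -> 'C(a, b)%:R != 0 :> F.
  by move=> le_ba; rewrite pnatr_eq0 -lt0n bin_gt0.
rewrite big_ord_recl esym_cons0 bin0 /=.
under eq_bigr => j _ do rewrite /bump /= add1n esym_consS mulrDr mulrDl.
rewrite big_split /= addrA.
(* These are the terms without [w]; the one at [m.+1] vanishes, as [s] has only [m] entries. *)
have -> : 1%:R^-1 * esym s 0 * p`_0 +
    \sum_(j < m.+1) 'C(m.+1, j.+1)%:R^-1 * esym s j.+1 * p`_j.+1
  = \sum_(j < m.+1) 'C(m.+1, j)%:R^-1 * esym s j * p`_j.
  rewrite big_ord_recr /= (@esym_oversize _ s m.+1) // mulr0 mul0r addr0.
  by rewrite [RHS]big_ord_recl bin0.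
rewrite -big_split mulr_sumr; apply: eq_bigr => j _ /=.
have lejm : (j <= m)%N by rewrite -ltnS.
rewrite coef_polar_deriv.
(* Both identities turn binomial weights for [m.+1] into weights for [m]; the factors left over are
   those of [coef_polar_deriv]. *)
have E1 : (m.+1%:R - j%:R) * 'C(m.+1, j)%:R = m.+1%:R * 'C(m, j)%:R :> F.
  by rewrite -natrB 1?leqW // -!natrM -mul_bin_down.
have E2 : j.+1%:R * 'C(m.+1, j.+1)%:R = m.+1%:R * 'C(m, j)%:R :> F.
  by rewrite -!natrM mul_bin_diag.
have V a b d : a != 0 -> b != 0 -> d * a = m.+1%:R * b ->
    a^-1 = m.+1%:R^-1 * (b^-1 * d) :> F.
  move=> a0 b0 dE; apply: (mulIf a0); rewrite mulVf // -!mulrA dE.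
  by rewrite [b^-1 * _]mulrCA mulVf // mulr1 mulVf // pnatr_eq0.
rewrite (V _ _ _ _ _ E1) ?(V _ _ _ _ _ E2) ?bn0 // 1?leqW //.
ring.
Qed.

Lemma polar_form_nseq (F : numFieldType) (p : {poly F}) k z :
  (size p <= k.+1)%N -> polar_form p (nseq k z) = p.[z].
Proof.
move=> sp; rewrite (horner_coef_wide _ sp) /polar_form size_nseq.
apply: eq_bigr => j _; rewrite esym_nseq mulKf 1?mulrC //.
by rewrite pnatr_eq0 -lt0n bin_gt0 -ltnS.
Qed.

Lemma horner_deriv_prod_XsubC (F : fieldType) (r : seq F) z :
  all (fun a => a != z) r ->
  (\prod_(a <- r) ('X - a%:P))^`().[z] =
    (\prod_(a <- r) ('X - a%:P)).[z] * \sum_(a <- r) (z - a)^-1.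
Proof.
elim: r => [|a r IHr] /=; first by rewrite !big_nil derivC horner0 mulr0.
case/andP=> az /IHr {}IHr; rewrite !big_cons derivM derivXsubC mul1r.
rewrite hornerD !hornerM IHr hornerXsubC; field.
by rewrite subr_eq0 eq_sym.
Qed.

Lemma codom_const (T : finType) (U : Type) (u : U) :
  codom (fun _ : T => u) = nseq #|T| u.
Proof. by rewrite /codom /image_mem cardE; elim: (enum _) => //= x s ->. Qed.

(** * Convexity of inverted complements of discs and half-planes *)

Section Regions.
Variable R : realType.
Implicit Types (D : set R[i]) (z w c : R[i]) (t : R).

Definition quad (A B C E u v : R) : R :=
  A * (u ^+ 2 + v ^+ 2) + B * u + C * v + E.

(* Discs ([A = 1]) and half-planes ([A = 0]) are handled uniformly. *)
Lemma region_quad D : disc_or_half_plane D ->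
  exists A B C E : R, 0 <= A /\
    ((forall z, D z <-> quad A B C E (complex.Re z) (complex.Im z) < 0) \/
     (forall z, D z <-> quad A B C E (complex.Re z) (complex.Im z) <= 0)).
Proof.
case=> [[c [r [r0 DE]]] | [a [b [_ DE]]]].
  exists 1, (- 2 * complex.Re c), (- 2 * complex.Im c),
    (complex.Re c ^+ 2 + complex.Im c ^+ 2 - r ^+ 2); split=> //.
  have r2 : r = Num.sqrt (r ^+ 2) by rewrite sqrtr_sqr gtr0_norm.
  have lt_r x : (Num.sqrt x < r) = (x < r ^+ 2).
    by rewrite {1}r2 ltr_sqrt // exprn_gt0.
  have le_r x : (Num.sqrt x <= r) = (x <= r ^+ 2).
    by rewrite {1}r2 ler_sqrt // exprn_ge0 // ltW.
  case: DE => ->; [left|right] => -[x y]; case: c => cx cy /=.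
    rewrite /open_disc /mkset normc_def ltcR lt_r.
    by split; rewrite /quad /=; lra.
  rewrite /closed_disc /mkset normc_def lecR le_r.
  by split; rewrite /quad /=; lra.
exists 0, (- complex.Re a), (complex.Im a), b; split=> //.
case: DE => ->; [left|right] => -[x y]; case: a => ax ay /=.
  rewrite /open_half_plane /=.
  by split; rewrite /quad /=; lra.
rewrite /closed_half_plane /=.
by split; rewrite /quad /=; lra.
Qed.

(* With the convention 1 / 0 = oo, this is the image of the complement of [D]
   in the Riemann sphere under v |-> 1 / (z - v). *)
Definition inv_compl D z c : Prop := c != 0 -> ~ D (z - c^-1).

(* [|c| ^ 2 * quad (z - 1 / c)] with the denominators cleared; it extends to
   [c = 0] with value [A], and its leading coefficient is [quad z]. *)
Definition inv_quad A B C E (z c : R[i]) : R :=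
  let: u +i* v := z in let: x +i* y := c in
  quad A B C E u v * (x ^+ 2 + y ^+ 2) + A * (1 - 2 * u * x + 2 * v * y)
    - B * x + C * y.

Lemma inv_quadP A B C E z c : c != 0 ->
  exists2 N : R, 0 < N &
    N * quad A B C E (complex.Re (z - c^-1)) (complex.Im (z - c^-1)) =
    inv_quad A B C E z c.
Proof.
case: c z => [x y] [u v]; rewrite eq_complex /= => xy0.
have N0 : x ^+ 2 + y ^+ 2 != 0.
  by rewrite paddr_eq0 ?sqr_ge0 // !sqrf_eq0.
exists (x ^+ 2 + y ^+ 2); first by rewrite lt_def N0 addr_ge0 ?sqr_ge0.
by rewrite /quad; field.
Qed.

(** In [c], [inv_quad] is an affine function plus [q * |c| ^ 2], where [q] is the value of [quad] at
    [z]. The two sides thus differ by [- q * t * (1 - t) * |c1 - c2| ^ 2]. *)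
Lemma inv_quad_concave A B C E z c1 c2 t : 0 <= t <= 1 ->
  quad A B C E (complex.Re z) (complex.Im z) <= 0 ->
  t * inv_quad A B C E z c1 + (1 - t) * inv_quad A B C E z c2 <=
  inv_quad A B C E z (t%:C * c1 + (1 - t)%:C * c2).
Proof.
case: c1 c2 z => [x1 y1] [x2 y2] [u v] /andP[t0 t1] /= q0.
rewrite -subr_ge0; set q := quad _ _ _ _ _ _ in q0 *.
have : 0 <= - q * (t * (1 - t)) * ((x1 - x2) ^+ 2 + (y1 - y2) ^+ 2).
  by rewrite !mulr_ge0 ?oppr_ge0 ?subr_ge0 ?addr_ge0 ?sqr_ge0.
by congr (is_true (_ <= _)); ring.
Qed.

Lemma inv_compl_convex D z c1 c2 t : disc_or_half_plane D -> D z ->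
  0 < t < 1 -> inv_compl D z c1 -> inv_compl D z c2 ->
  inv_compl D z (t%:C * c1 + (1 - t)%:C * c2).
Proof.
case/region_quad => A [B [C [E [A0 Dq]]]] Dz /andP[t0 t1] S1 S2.
set c := _ + _; have s0 : 0 < 1 - t by rewrite subr_gt0.
pose G := inv_quad A B C E z.
have G_conc : t * G c1 + (1 - t) * G c2 <= G c.
  apply: inv_quad_concave; first by rewrite !ltW.
  by case: Dq Dz => Dq /Dq // /ltW.
have [c0|c0 _] := eqVneq c 0; first by move/eqP; rewrite c0.
have [N N0 NE] := inv_quadP A B C E z c0.
case: Dq => Dq /Dq.
  have G0 d : inv_compl D z d -> 0 <= G d.
    have [-> _|d0 /(_ d0) Sd] := eqVneq d 0.
      by rewrite /G; case: (z) => u v /=; lra.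
    have [M M0 ME] := inv_quadP A B C E z d0.
    by rewrite /G -ME pmulr_rge0 // leNgt; apply/negP => /Dq.
  rewrite ltNge -(pmulr_rge0 _ N0) NE (le_trans _ G_conc) //.
  by rewrite addr_ge0 // mulr_ge0 ?G0 // ltW.
(* For closed [D] the inequality must be strict, but [G 0 = A] is zero for a half-plane; hence the
   separate case [d = 0]. *)
have G0 d : inv_compl D z d -> d = 0 \/ 0 < G d.
  have [-> _|d0 /(_ d0) Sd] := eqVneq d 0; [by left | right].
  have [M M0 ME] := inv_quadP A B C E z d0.
  by rewrite /G -ME pmulr_rgt0 // ltNge; apply/negP => /Dq.
have G00 : 0 <= G 0 by rewrite /G; case: (z) => u v /=; lra.
rewrite leNgt -(pmulr_rgt0 _ N0) NE => /negP; apply.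
apply: lt_le_trans G_conc.
case: (G0 _ S1) (G0 _ S2) => [E1|G1] [E2|G2].
- by case/eqP: c0; rewrite /c E1 E2 !mulr0 addr0.
- by rewrite E1 ltr_wpDl ?mulr_gt0 // mulr_ge0 // ltW.
- by rewrite E2 ltr_pwDl ?mulr_gt0 // mulr_ge0 // ltW.
- by rewrite addr_gt0 ?mulr_gt0.
Qed.

Lemma inv_compl_mean D z (s : seq R[i]) : disc_or_half_plane D -> D z ->
  (forall c, c \in s -> inv_compl D z c) ->
  inv_compl D z ((size s)%:R^-1 * \sum_(c <- s) c).
Proof.
move=> Dreg Dz; elim: s => [|c s IHs] Ss.
  by rewrite big_nil mulr0 /inv_compl eqxx.
have Sc : inv_compl D z c by apply: Ss; rewrite mem_head.
have {}IHs : inv_compl D z ((size s)%:R^-1 * \sum_(c <- s) c).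
  by apply: IHs => d ds; apply: Ss; rewrite in_cons ds orbT.
(* A singleton would give the weight [t = 1], outside the open interval. *)
case: s IHs {Ss} => [|d s] IHs; first by rewrite big_seq1 invr1 mul1r.
rewrite big_cons /=; set m := size (d :: s) in IHs *.
have t01 : 0 < (m.+1%:R : R)^-1 < 1.
  by rewrite invr_gt0 ltr0n invf_lt1 ?ltr0n // ltr1n.
have := inv_compl_convex Dreg Dz t01 Sc IHs.
congr inv_compl; rewrite rmorphB rmorph1 fmorphV rmorph_nat mulrDr.
congr (_ + _); rewrite mulrA; congr (_ * _).
have m0 : m%:R != 0 :> R[i] by rewrite pnatr_eq0.
have m1 : m.+1%:R != 0 :> R[i] by rewrite pnatr_eq0.
by rewrite -natr1 in m1 *; field; rewrite m0 m1.
Qed.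

(** * From Laguerre to Grace-Walsh-Szego *)

Lemma laguerre D (p : {poly R[i]}) k z w :
  disc_or_half_plane D -> D z -> D w -> (size p <= k.+2)%N ->
  (forall v, D v -> p.[v] != 0) -> (polar_deriv k.+1 w p).[z] != 0.
Proof.
move=> Dreg Dz Dw sp pD.
have p0 : p != 0 by apply: contraNneq (pD _ Dz) => ->; rewrite horner0.
have [r pE] := closed_field_poly_normal p.
have sr : (size r <= k.+1)%N.
  move: sp; rewrite pE size_scale ?lead_coef_eq0 //.
  by rewrite size_prod_XsubC.
have r_notin a : a \in r -> ~ D a.
  move=> ar Da; have /negP[] := pD _ Da.
  rewrite pE hornerZ mulf_eq0 -[_.[a] == 0]/(root _ a).
  by rewrite root_prod_XsubC ar orbT.
have p'E : p^`().[z] = p.[z] * \sum_(a <- r) (z - a)^-1.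
  rewrite {1 2}pE derivZ !hornerZ horner_deriv_prod_XsubC ?mulrA //.
  by apply/allP => a ar; apply: contraPneq Dz => <-; apply: r_notin.
(* The padding zeros act as roots at infinity when [p] has degree below [k.+1]. *)
pose s := [seq (z - a)^-1 | a <- r] ++ nseq (k.+1 - size r) 0.
have size_s : size s = k.+1 by rewrite size_cat size_map size_nseq subnKC.
have sumE : \sum_(c <- s) c = \sum_(a <- r) (z - a)^-1.
  by rewrite big_cat big_map /= big_nseq iter_addr addr0 mul0rn addr0.
have Ss c : c \in s -> inv_compl D z c.
  rewrite mem_cat => /orP[/mapP[a ar ->] _|/nseqP[-> _]].
    by rewrite invrK subKr; apply: r_notin.
  by rewrite /inv_compl eqxx.
have := inv_compl_mean Dreg Dz Ss; rewrite size_s sumE.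
set zeta : R[i] := _ * _ => zetaP.
have k0 : k.+1%:R != 0 :> R[i] by rewrite pnatr_eq0.
have -> : (polar_deriv k.+1 w p).[z] = p.[z] * k.+1%:R * (1 + (w - z) * zeta).
  rewrite /polar_deriv hornerD hornerMn hornerM hornerD hornerN hornerC hornerX.
  rewrite p'E -mulr_natr.
  rewrite /zeta; move: (\sum_(a <- r) _) (p.[z]) => S q.
  by rewrite mulrDr mulr1; field; rewrite nat1r.
apply: mulf_neq0; first by rewrite mulf_neq0 ?pD.
apply/eqP => e0.
have zw : (z - w) * zeta = 1.
  by move/eqP: e0; rewrite addr_eq0 -mulNr opprB => /eqP.
have zeta0 : zeta != 0.
  by apply: contra_eq_neq zw => ->; rewrite mulr0 eq_sym oner_eq0.
apply: (zetaP zeta0); suff -> : zeta^-1 = z - w by rewrite subKr.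
by apply: (mulIf zeta0); rewrite mulVf.
Qed.

Lemma grace_walsh_szego D (p : {poly R[i]}) z (s : seq R[i]) :
  disc_or_half_plane D -> D z -> (forall c, c \in s -> D c) ->
  (size p <= (size s).+1)%N -> (forall v, D v -> p.[v] != 0) ->
  polar_form p s != 0.
Proof.
move=> Dreg Dz; elim: s p => [|c s IHs] p Ds sp pD.
  (* With no variables left, [p] is the constant [p.[z]]. *)
  rewrite /polar_form big_ord1 esym_nil bin0 invr1 !mul1r.
  by move: (pD _ Dz); rewrite {1}(size1_polyC sp) hornerC.
have Dc : D c by apply: Ds; rewrite mem_head.
rewrite polar_form_cons mulf_neq0 ?invr_eq0 ?pnatr_eq0 //.
apply: IHs => [d ds||v Dv]; first by apply: Ds; rewrite in_cons ds orbT.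
  exact: size_polar_deriv.
exact: (laguerre Dreg Dv Dc sp pD).
Qed.

(** * Reduction of matrix polynomials to scalar ones *)

Lemma bilinear_poly n (P : 'M[{poly R[i]}]_n) (x y : 'cV[R[i]]_n) d :
  mxpoly_deg_le d P ->
  exists p : {poly R[i]}, [/\ (size p <= d.+1)%N,
    forall z, p.[z] = (y^t* *m mxpoly_eval P z *m x) 0 0 &
    forall j, p`_j = (y^t* *m mxpoly_coef P j *m x) 0 0].
Proof.
move=> Pd.
pose p := \sum_j (\sum_i (y^t*) 0 i *: P i j) * (x j 0)%:P.
exists p; split.
- apply/leq_sizeP => k dk; rewrite /p coef_sum big1 // => j _.
  rewrite coefMC coef_sum big1 ?mul0r // => i _.
  by rewrite coefZ nth_default ?mulr0 // (leq_trans (Pd i j)).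
- move=> z; rewrite /p horner_sum mxE; apply: eq_bigr => j _.
  rewrite hornerM hornerC horner_sum mxE; congr (_ * _).
  by apply: eq_bigr => i _; rewrite hornerZ [mxpoly_eval _ _ _ _]mxE.
- move=> k; rewrite /p coef_sum mxE; apply: eq_bigr => j _.
  rewrite coefMC coef_sum mxE; congr (_ * _).
  by apply: eq_bigr => i _; rewrite coefZ [mxpoly_coef _ _ _ _]mxE.
Qed.

Lemma mxmpoly_eval_polarisation n k (P : 'M[{poly R[i]}]_n) (w : 'I_k -> R[i]) :
  mxmpoly_eval (polarisation k P) w =
  \sum_(j < k.+1) (('C(k, j)%:R)^-1 * esym (codom w) j) *: mxpoly_coef P j.
Proof.
apply/matrixP => a b; rewrite mxE /polarisation !summxE raddf_sum /=.
apply: eq_bigr => j _; rewrite !mxE mevalM mevalZ mevalC.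
by rewrite meval_mesym.
Qed.
End Regions.

Theorem theorem6p4 (R : realType) (n k : nat) (D : set R[i])
    (P : 'M[{poly R[i]}]_n) :
  (0 < k)%N ->
  disc_or_half_plane D ->
  mxpoly_deg_le k P ->
  hyperstable1 D P <-> hyperstable (set_power D k) (polarisation k P).
Proof.
move=> k0 Dreg Pk.
have key (x y : 'cV[R[i]]_n) : exists p : {poly R[i]}, [/\ (size p <= k.+1)%N,
    forall z, p.[z] = (y^t* *m mxpoly_eval P z *m x) 0 0 &
    forall w, polar_form p (codom w) =
      (y^t* *m mxmpoly_eval (polarisation k P) w *m x) 0 0].
  have [p [sp pz pj]] := bilinear_poly x y Pk; exists p; split=> // w.
  rewrite mxmpoly_eval_polarisation mulmx_sumr mulmx_suml summxE /polar_form.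
  rewrite size_codom card_ord; apply: eq_bigr => j _.
  by rewrite pj -scalemxAr -scalemxAl [RHS]mxE.
split=> PD x x0; have [y y0 yP] := PD x x0; exists y => // w Dw.
  have [p [sp pz <-]] := key x y.
  (* As [k] is positive, the first coordinate of [w] supplies a point of [D]. *)
  apply: (grace_walsh_szego Dreg (Dw (Ordinal k0))).
  - by move=> c /codomP[i ->].
  - by rewrite size_codom card_ord.
  - by move=> v /yP; rewrite pz.
have [p [sp pz pw]] := key x y.
rewrite -pz -(polar_form_nseq _ sp).
have := yP (fun=> w) (fun=> Dw); rewrite -pw.
by rewrite codom_const card_ord.
Qed.
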